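(* Let $(\mathbf W(\omega))_\omega\subseteq\mathscr C^\alpha(\mathbb R,\mathbb R^M)$ be a weakly geometric rough path cocycle over a metric dynamical system $(\Omega,\mathcal F,P,(\theta_t)_{t\in\mathbb R})$ that satisfies $\int_\Omega\|\mathbf W(\omega)\|_{\mathscr C^\alpha}^{1/\alpha}\,\mathrm dP(\omega)<\infty$ on compact intervals. Let $B_0\in\mathscr L(\mathbb R^D,\mathbb R^D)$, $B\in\mathscr L(\mathbb R^D,\mathscr L(\mathbb R^M,\mathbb R^D))$, and let $\Phi$ be the linear cocycle generated by the linear RDE $\mathrm dY_t=B_0Y_t\,\mathrm dt+BY_t\,\mathrm d\mathbf W_t(\omega)$ in $\mathbb R^D$. Then $\Phi$ meets the integrability condition of the multiplicative ergodic theorem, that is, $$\int_\Omega\Big(\sup_{t\in[0,1]}\log^+|\Phi(t,\omega)|+\sup_{t\in[0,1]}\log^+|\Phi(t,\omega)^{-1}|\Big)\,\mathrm dP(\omega)<\infty.$$ In particular, the multiplicative ergodic theorem applies to $\Phi$.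
   Context: Fix $\alpha\in(1/3,1/2]$; $X_{s,t}:=X_t-X_s$; $\log^+x=\max\{\log x,0\}$. For compact $I$, $\mathscr C^\alpha(I,\mathbb V)$ is the set of pairs $\mathbf W=(W,\mathbb W)$, $W:I\to\mathbb V$, $\mathbb W:I^2\to\mathbb V\otimes\mathbb V$, with $\|W\|_\alpha=\sup_{s<t}|W_{s,t}|/(t-s)^\alpha<\infty$, $\|\mathbb W\|_{2\alpha}=\sup_{s<t}|\mathbb W_{s,t}|/(t-s)^{2\alpha}<\infty$ and $W_{s,u}\otimes W_{u,t}=\mathbb W_{s,t}-\mathbb W_{s,u}-\mathbb W_{u,t}$ for $s<u<t$; $\|\mathbf W\|_{\mathscr C^\alpha}=\|W\|_\alpha+\|\mathbb W\|_{2\alpha}$. Weakly geometric: $\mathrm{Sym}(\mathbb W_{s,t})=\frac12W_{s,t}\otimes W_{s,t}$ for $s<t$. $\mathscr C^\alpha(\mathbb R,\mathbb V)$: pairs whose restrictions to all compact intervals containing $0$ are in $\mathscr C^\alpha(I,\mathbb V)$. Controlled rough paths $(Y,Y')$ have $Y,Y'$ $\alpha$-Hölder and $\sup_{s<t}|Y_{s,t}-Y'_sW_{s,t}|/(t-s)^{2\alpha}<\infty$; $\int_s^tY\,\mathrm d\mathbf W=\lim_{|\mathrm P|\to0}\sum_{[u,v]\in\mathrm P}Y_uW_{u,v}+Y'_u\mathbb W_{u,v}$. The RDE means $Y_t=Y_0+\int_0^tB_0Y_s\,\mathrm ds+\int_0^tBY_s\,\mathrm d\mathbf W_s$ for $t\ge0$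 (and $Y_t=Y_0-\int_t^0\cdots$ for $t<0$) with $Y'=BY$; $\Phi(t,\omega)y$ is its solution at time $t$ with $Y_0=y$. A metric dynamical system is a probability space with a measurable flow $(t,\omega)\mapsto\theta_t\omega$ of $P$-preserving maps, $\theta_0=\mathrm{id}$, $\theta_{t+s}=\theta_t\theta_s$. A rough path cocycle satisfies $\mathbf W_{t_1+s,t_2+s}(\omega)=\mathbf W_{t_1,t_2}(\theta_s\omega)$ for all $\omega$ and $s,t_1,t_2$, $t_1<t_2$. The multiplicative ergodic theorem (Oseledets) states that a linear cocycle $\Psi$ on $\mathbb R^D$ over a metric dynamical system satisfying the integrability condition $\int_\Omega\big(\sup_{t\in[0,1]}\log^+|\Psi(t,\omega)|+\sup_{t\in[0,1]}\log^+|\Psi(t,\omega)^{-1}|\big)\,\mathrm dP(\omega)<\infty$ admits, on a $\theta$-invariant set of full measure, the measurable invariant Oseledets splitting of $\mathbb R^D$ with associated Lyapunov exponents. *)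

(* Defs.v *)
From HB Require Import structures.
From mathcomp Require Import all_boot all_order all_algebra.
From mathcomp Require Import all_classical all_reals all_analysis.

Set Implicit Arguments.
Unset Strict Implicit.
Unset Printing Implicit Defensive.

Import Order.TTheory GRing.Theory Num.Theory.
Import numFieldNormedType.Exports.

Local Open Scope classical_set_scope.
Local Open Scope ring_scope.

(** Vectors of R^n are column vectors, L(R^m, R^n) is ['M_(n, m)], and all norms
    are the library's (maximum) norms on matrices; every finiteness statement
    below is insensitive to the choice of norms in finite dimension. *)

(** ** Rough paths *)

(** The tensor product R^M (x) R^M is ['M_M]; the row index is the first tensor
    factor. *)
Definition tensor {R : realType} {M : nat} (u v : 'cV[R]_M) : 'M[R]_M :=
  u *m v^T.

(** Increments only: the second level [level2 W s t] is meaningful for [s < t]. *)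
Record two_level_path (R : realType) (M : nat) := TwoLevelPath {
  level1 : R -> 'cV[R]_M ;
  level2 : R -> R -> 'M[R]_M }.

Definition incr {R : realType} {E : zmodType} (X : R -> E) (s t : R) : E :=
  X t - X s.

(** [sup_(a <= s < t <= b) |A s t| / (t - s)^beta], possibly [+oo]. It is [-oo]
    when [b <= a], so it is only used as a norm for [a < b]. *)
Definition holder2 {R : realType} {E : normedModType R} (beta a b : R)
    (A : R -> R -> E) : \bar R :=
  ereal_sup [set x | exists s t, [/\ a <= s, s < t, t <= b &
                                     x = (`|A s t| / (t - s) `^ beta)%:E]].

Definition rough_norm {R : realType} {M : nat} (alpha a b : R)
    (W : two_level_path R M) : \bar R :=
  (holder2 alpha a b (incr (level1 W)) + holder2 (2 * alpha) a b (level2 W))%E.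

Record rough_path_on {R : realType} {M : nat} (alpha a b : R)
    (W : two_level_path R M) : Prop := RoughPathOn {
  rough_level1 : (holder2 alpha a b (incr (level1 W)) < +oo)%E ;
  rough_level2 : (holder2 (2 * alpha) a b (level2 W) < +oo)%E ;
  rough_chen : forall s u t, a <= s -> s < u -> u < t -> t <= b ->
    tensor (incr (level1 W) s u) (incr (level1 W) u t) =
    level2 W s t - level2 W s u - level2 W u t }.

Definition rough_path {R : realType} {M : nat} (alpha : R)
    (W : two_level_path R M) : Prop :=
  forall a b, a <= 0 -> 0 <= b -> rough_path_on alpha a b W.

Definition weakly_geometric {R : realType} {M : nat}
    (W : two_level_path R M) : Prop :=
  forall s t, s < t ->
    2^-1 *: (level2 W s t + (level2 W s t)^T) =
    2^-1 *: tensor (incr (level1 W) s t) (incr (level1 W) s t).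

(** ** Controlled rough paths and the rough integral *)

(** The Gubinelli derivative [Y' s], an element of L(R^M, E), is given by its
    values [Y' s k] on the standard basis of R^M. *)
Record controlled_on {R : realType} {M : nat} {E : normedModType R}
    (alpha a b : R) (W : two_level_path R M)
    (Y : R -> E) (Y' : R -> 'I_M -> E) : Prop := ControlledOn {
  controlled_path : (holder2 alpha a b (incr Y) < +oo)%E ;
  controlled_deriv : forall k, (holder2 alpha a b (incr (Y' ^~ k)) < +oo)%E ;
  controlled_remainder :
    (holder2 (2 * alpha) a b
       (fun s t => incr Y s t
                   - \sum_(k < M) incr (level1 W) s t k 0 *: Y' s k)%R
     < +oo)%E }.

(** [Z_u W_{u,v} + Z'_u WW_{u,v}] for [Z] with values in L(R^M, R^D): the
    direction of [Z'_u] is paired with the first tensor factor and the argument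
    of the resulting element of L(R^M, R^D) with the second one. *)
Definition rough_germ {R : realType} {M D : nat} (W : two_level_path R M)
    (Z : R -> 'M[R]_(D, M)) (Z' : R -> 'I_M -> 'M[R]_(D, M))
    (u v : R) : 'cV[R]_D :=
  Z u *m incr (level1 W) u v
  + \sum_(k < M) \sum_(l < M) level2 W u v k l *: col l (Z' u k).

Definition germ_sum {R : realType} {E : zmodType} (A : R -> R -> E) (s t : R)
    (p : seq R) : E :=
  \sum_(0 <= i < size p) A (nth t (s :: p) i) (nth t (s :: p) i.+1).

Definition mesh_lt {R : realType} (s t : R) (p : seq R) (delta : R) : Prop :=
  forall i, (i < size p)%N ->
    nth t (s :: p) i.+1 - nth t (s :: p) i < delta.

(** [J] is the limit of the compensated Riemann sums on [[s, t]] as the mesh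
    tends to 0. *)
Definition is_rough_integral {R : realType} {M D : nat}
    (W : two_level_path R M) (Z : R -> 'M[R]_(D, M))
    (Z' : R -> 'I_M -> 'M[R]_(D, M)) (s t : R) (J : 'cV[R]_D) : Prop :=
  forall eps, 0 < eps -> exists2 delta, 0 < delta &
    forall p, itv_partition s t p -> mesh_lt s t p delta ->
      `|germ_sum (rough_germ W Z Z') s t p - J| < eps.

(** ** The linear rough differential equation *)

Definition drift_integral {R : realType} {D : nat} (B0 : 'M[R]_D)
    (Y : R -> 'cV[R]_D) (s t : R) : 'cV[R]_D :=
  \col_i (\int[lebesgue_measure]_(r in `[s, t]) (B0 *m Y r) i 0).

(** The solution is controlled with [Y' = B Y], i.e. [Y'_s e_k = (B Y_s) e_k];
    the integrand [B Y] is then controlled with derivative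
    [v |-> B (Y'_s v)]. *)
Definition rde_deriv {R : realType} {M D : nat}
    (B : {linear 'cV[R]_D -> 'M[R]_(D, M)}) (Y : R -> 'cV[R]_D)
    (s : R) (k : 'I_M) : 'cV[R]_D :=
  col k (B (Y s)).

Definition is_diffusion_integral {R : realType} {M D : nat}
    (B : {linear 'cV[R]_D -> 'M[R]_(D, M)}) (W : two_level_path R M)
    (Y : R -> 'cV[R]_D) (s t : R) (J : 'cV[R]_D) : Prop :=
  is_rough_integral W (fun u => B (Y u)) (fun u k => B (rde_deriv B Y u k)) s t J.

Record rde_solution {R : realType} {M D : nat} (alpha : R) (B0 : 'M[R]_D)
    (B : {linear 'cV[R]_D -> 'M[R]_(D, M)}) (W : two_level_path R M)
    (Y : R -> 'cV[R]_D) : Prop := RdeSolution {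
  rde_controlled : forall a b, controlled_on alpha a b W Y (rde_deriv B Y) ;
  rde_forward : forall t, 0 <= t ->
    exists2 J, is_diffusion_integral B W Y 0 t J &
      Y t = Y 0 + drift_integral B0 Y 0 t + J ;
  rde_backward : forall t, t < 0 ->
    exists2 J, is_diffusion_integral B W Y t 0 J &
      Y t = Y 0 - drift_integral B0 Y t 0 - J }.

(** ** Random dynamical systems *)

Record metric_dynamical_system {R : realType} {d : measure_display}
    {Omega : measurableType d} (P : probability Omega R)
    (theta : R -> Omega -> Omega) : Prop := MetricDynamicalSystem {
  mds_measurable :
    measurable_fun [set: R * Omega] (fun x => theta x.1 x.2) ;
  mds_preserving : forall t A, measurable A -> P (theta t @^-1` A) = P A ;
  mds_flow0 : forall omega, theta 0 omega = omega ;
  mds_flowD : forall t s omega, theta (t + s) omega = theta t (theta s omega) }.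

Record rough_path_cocycle {R : realType} {M : nat} {Omega : Type} (alpha : R)
    (theta : R -> Omega -> Omega) (W : Omega -> two_level_path R M) : Prop :=
  RoughPathCocycle {
  rpc_rough : forall omega, rough_path alpha (W omega) ;
  rpc_level1 : forall omega s t1 t2, t1 < t2 ->
    incr (level1 (W omega)) (t1 + s) (t2 + s) =
    incr (level1 (W (theta s omega))) t1 t2 ;
  rpc_level2 : forall omega s t1 t2, t1 < t2 ->
    level2 (W omega) (t1 + s) (t2 + s) = level2 (W (theta s omega)) t1 t2 }.

(** Linear (continuous) cocycles over [theta] in two-sided time; invertibility
    of [Phi t omega] is a consequence of the cocycle property. *)
Record linear_cocycle {R : realType} {d : measure_display}
    {Omega : measurableType d} {D : nat} (theta : R -> Omega -> Omega)
    (Phi : R -> Omega -> 'M[R]_D) : Prop := LinearCocycle {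
  lc_measurable : forall i j,
    measurable_fun [set: R * Omega] (fun x => Phi x.1 x.2 i j) ;
  lc_continuous : forall omega, continuous (Phi ^~ omega) ;
  lc_cocycle0 : forall omega, Phi 0 omega = 1%:M ;
  lc_cocycleD : forall t s omega,
    Phi (t + s) omega = Phi t (theta s omega) *m Phi s omega }.

(** [Phi t omega y] is the value at time [t] of the solution started at [y]. *)
Definition generated_by_rde {R : realType} {M D : nat} {Omega : Type} (alpha : R)
    (B0 : 'M[R]_D) (B : {linear 'cV[R]_D -> 'M[R]_(D, M)})
    (W : Omega -> two_level_path R M) (Phi : R -> Omega -> 'M[R]_D) : Prop :=
  forall omega (y : 'cV[R]_D),
    rde_solution alpha B0 B (W omega) (fun t => Phi t omega *m y) /\
    Phi 0 omega *m y = y.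

(** ** The multiplicative ergodic theorem *)

(** [ln x] is 0 for [x <= 0], so that [log_plus 0 = 0] as usual. *)
Definition log_plus {R : realType} (x : R) : R := Num.max (ln x) 0.

Definition met_integrable {R : realType} {d : measure_display}
    {Omega : measurableType d} {D : nat} (P : probability Omega R)
    (Phi : R -> Omega -> 'M[R]_D) : Prop :=
  P.-integrable setT (fun omega =>
    ereal_sup [set (log_plus `|Phi t omega|)%:E | t in `[0%R, 1%R]] +
    ereal_sup [set (log_plus `|invmx (Phi t omega)|)%:E | t in `[0%R, 1%R]])%E.

(** The measurable invariant splitting [R^D = E_0 (+) ... (+) E_(p-1)] on an
    invariant set [Omega0] of full measure, with the Lyapunov exponents
    [lambda_0 > ... > lambda_(p-1)]. [P] need not be ergodic, so [p] and
    [lambda] depend on [omega]. Measurability of the subspaces is that of random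
    closed sets: [E_i] hits a given open set on a measurable event. *)
Record oseledets_splitting {R : realType} {d : measure_display}
    {Omega : measurableType d} {D : nat} (P : probability Omega R)
    (theta : R -> Omega -> Omega) (Phi : R -> Omega -> 'M[R]_D)
    (Omega0 : set Omega) (p : Omega -> nat) (lambda : Omega -> nat -> R)
    (E : Omega -> nat -> {vspace 'cV[R]_D}) : Prop := OseledetsSplitting {
  os_set_measurable : measurable Omega0 ;
  os_set_full : P Omega0 = 1%E ;
  os_set_invariant : forall t, theta t @^-1` Omega0 = Omega0 ;
  os_number_measurable : measurable_fun Omega0 p ;
  os_exponent_measurable : forall i,
    measurable_fun (Omega0 `&` [set omega | (i < p omega)%N]) (lambda ^~ i) ;
  os_space_measurable : forall i (U : set 'cV[R]_D), open U ->
    measurable (Omega0 `&` [set omega | (i < p omega)%N /\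
                              exists2 v, v \in E omega i & U v]) ;
  os_exponent_decreasing : forall omega, Omega0 omega ->
    forall i j, (i < j < p omega)%N -> lambda omega j < lambda omega i ;
  os_space_neq0 : forall omega, Omega0 omega ->
    forall i, (i < p omega)%N -> E omega i != 0%VS ;
  os_direct : forall omega, Omega0 omega ->
    directv (\sum_(i < p omega) E omega i)%VS ;
  os_full : forall omega, Omega0 omega ->
    (\sum_(i < p omega) E omega i)%VS = fullv ;
  os_number_invariant : forall omega t, Omega0 omega ->
    p (theta t omega) = p omega ;
  os_exponent_invariant : forall omega t i, Omega0 omega -> (i < p omega)%N ->
    lambda (theta t omega) i = lambda omega i ;
  os_space_invariant : forall omega t i, Omega0 omega -> (i < p omega)%N ->
    (linfun (mulmx (Phi t omega)) @: E omega i)%VS = E (theta t omega) i ;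
  os_lyapunov : forall omega i v, Omega0 omega -> (i < p omega)%N ->
    v \in E omega i -> v != 0 ->
    (t^-1 * ln `|Phi t omega *m v| @[t --> +oo] --> lambda omega i) /\
    (t^-1 * ln `|Phi t omega *m v| @[t --> -oo] --> lambda omega i) }.

Definition has_oseledets_splitting {R : realType} {d : measure_display}
    {Omega : measurableType d} {D : nat} (P : probability Omega R)
    (theta : R -> Omega -> Omega) (Phi : R -> Omega -> 'M[R]_D) : Prop :=
  exists Omega0 p lambda E,
    oseledets_splitting P theta Phi Omega0 p lambda E.

Definition multiplicative_ergodic_theorem (R : realType) (D : nat) : Prop :=
  forall (d : measure_display) (Omega : measurableType d)
    (P : probability Omega R) (theta : R -> Omega -> Omega)
    (Psi : R -> Omega -> 'M[R]_D),
    metric_dynamical_system P theta -> linear_cocycle theta Psi ->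
    met_integrable P Psi -> has_oseledets_splitting P theta Psi.

(* Main.v *)
Require Import Defs.
From HB Require Import structures.
From mathcomp Require Import all_boot all_order all_algebra.
From mathcomp Require Import all_classical all_reals all_analysis.
From mathcomp Require Import measurable_realfun ring lra.
Import Order.TTheory GRing.Theory Num.Theory.
Import numFieldNormedType.Exports.
Set Implicit Arguments.
Unset Strict Implicit.
Unset Printing Implicit Defensive.
Local Open Scope classical_set_scope.
Local Open Scope ring_scope.

(** Over a time step of length h on which h^alpha (1 + |W|) is below a
    threshold depending only on alpha and on the coefficients, a solution of
    the linear equation moves by at most half of its initial size: writing the
    solution as a controlled path, the sewing estimate bounds the remainder of
    its expansion by the Hoelder seminorms of the path and of the remainder
    themselves, with a small factor, so that these seminorms are absorbed
    ([rde_local_increment]). Hence the norm of the solution at most doubles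
    and at most halves over such a step. The unit interval is covered by n
    equal steps with n of order (1 + |W|)^(1/alpha), which gives
    |Phi t y| <= 2^n |y| and, since halving is controlled as well,
    |y| <= 2^n |Phi t y| ([rde_growth]). The two bounds say that
    log^+ |Phi t| and log^+ |Phi t ^-1| are at most n for all t in [0, 1],
    and n is integrable because |W|^(1/alpha) is.

    The sewing estimate is needed only for an integral that is known to exist
    as a limit over all partitions. It can therefore be computed along dyadic
    partitions, where the bound |sum - A s t| <= L (t - s)^theta propagates
    from one level to the next as soon as K + 2^(1 - theta) L <= L, K being the
    constant in the bound of the defect A s t - A s u - A u t
    ([dyadic_germ_sum_bound]). For the germ of the equation, Chen's relation
    writes this defect in terms of the remainder of the solution and of the
    increments of the driving path ([rde_germ_defect]).

    The supremum over the uncountable interval [0, 1] is measurable because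
    the paths of the cocycle and of its inverse are continuous, so that a
    countable dense set of times suffices ([measurable_sup_unit_itv]). *)

(** * Maximum norm and continuity of matrices *)

Lemma normr_mx_le (R : realType) m n (A : 'M[R]_(m, n)) (c : R) :
  0 <= c -> (forall i j, `|A i j| <= c) -> `|A| <= c.
Proof.
move=> c0 Ac; rewrite [leLHS]/Num.Def.normr /= mx_normrE.
by apply: bigmax_le => // -[i j] _; exact: Ac.
Qed.

Lemma normr_mx_entry (R : realType) m n (A : 'M[R]_(m, n)) i j :
  `|A i j| <= `|A|.
Proof.
rewrite [leRHS]/Num.Def.normr /= mx_normrE.
by apply/bigmax_geP; right => /=; exists (i, j).
Qed.

Lemma normr_mulmx (R : realType) m n p (A : 'M[R]_(m, n)) (B : 'M[R]_(n, p)) :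
  `|A *m B| <= n%:R * `|A| * `|B|.
Proof.
apply: normr_mx_le => [|i j]; first by rewrite !mulr_ge0.
rewrite mxE (le_trans (ler_norm_sum _ _ _))//.
rewrite -mulrA mulr_natl -[X in _ *+ X]card_ord -sumr_const ler_sum// => k _.
by rewrite normrM ler_pM// normr_mx_entry.
Qed.

Lemma normr_col (R : realType) m n (A : 'M[R]_(m, n)) j : `|col j A| <= `|A|.
Proof. by apply: normr_mx_le => // i k; rewrite mxE normr_mx_entry. Qed.

Lemma linear_cV_bounded (R : realType) D m n
    (B : {linear 'cV[R]_D -> 'M[R]_(m, n)}) :
  exists2 c, 0 <= c & forall v, `|B v| <= c * `|v|.
Proof.
exists (\sum_(i < D) `|B (delta_mx i 0)|); first exact: sumr_ge0.
move=> v; rewrite [in leLHS](matrix_sum_delta v).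
under eq_bigr do rewrite big_ord1.
rewrite linear_sum (le_trans (ler_norm_sum _ _ _))// mulr_suml ler_sum// => i _.
by rewrite linearZ normrZ mulrC ler_wpM2l// normr_mx_entry.
Qed.

(** The maximum norm of a matrix is below its operator norm, as the columns are
    the images of the unit vectors. This passes from bounds on solutions to
    bounds on the cocycle. *)
Lemma normr_mx_operator (R : realType) m n (A : 'M[R]_(m, n)) K : 0 <= K ->
  (forall y : 'cV_n, `|A *m y| <= K * `|y|) -> `|A| <= K.
Proof.
move=> K0 AK; apply: normr_mx_le => // i j.
have -> : A i j = (A *m delta_mx j (0 : 'I_1)) i 0 by rewrite -colE mxE.
rewrite (le_trans (normr_mx_entry _ _ _))// (le_trans (AK _))// ler_piMr//.
apply: normr_mx_le => // k l.
by rewrite mxE; case: (_ && _); rewrite ?normr1 ?normr0.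
Qed.

Section matrix_continuity.
Context {R : realType}.

Lemma continuous_mx (T : topologicalType) m n (A : T -> 'M[R]_(m, n)) t :
  (forall i j, {for t, continuous (fun x => A x i j)}) -> {for t, continuous A}.
Proof.
move=> Ac; apply/cvgrPdist_le => e e0.
have : \forall x \near t, forall ij : 'I_m * 'I_n,
    `|A t ij.1 ij.2 - A x ij.1 ij.2| <= e.
  by apply: filter_forall => -[i j]; by have /cvgrPdist_le := Ac i j; apply.
apply: filterS => x Ax; apply: normr_mx_le => [|i j]; first exact: ltW.
by rewrite !mxE; exact: (Ax (i, j)).
Qed.

Lemma continuous_mx_entry (T : topologicalType) m n (A : T -> 'M[R]_(m, n)) t i j :
  {for t, continuous A} -> {for t, continuous (fun x => A x i j)}.
Proof. by move=> Ac; exact: (continuous_cvg _ (@coord_continuous _ _ _ _ _ (A t)) Ac). Qed.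

Lemma continuous_mulmx (T : topologicalType) m n p (A : T -> 'M[R]_(m, n))
    (B : T -> 'M[R]_(n, p)) t :
  {for t, continuous A} -> {for t, continuous B} ->
  {for t, continuous (fun x => A x *m B x)}.
Proof.
move=> Ac Bc; apply: continuous_mx => i j.
rewrite (_ : (fun x => _) = fun x => \sum_k A x i k * B x k j); last first.
  by apply/funext => x; rewrite mxE.
apply: (@cvg_big _ _ _ _ _ add_continuous) => k _.
by apply: cvgM; exact: continuous_mx_entry.
Qed.

Lemma continuous_det (T : topologicalType) n (A : T -> 'M[R]_n) t :
  (forall i j, {for t, continuous (fun x => A x i j)}) ->
  {for t, continuous (fun x => \det (A x))}.
Proof.
move=> Ac; rewrite /determinant.
apply: (@cvg_big _ _ _ _ _ add_continuous) => s _.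
apply: cvgM; first exact: cvg_cst.
by apply: (@cvg_big _ _ _ _ _ mul_continuous) => i _; exact: Ac.
Qed.

(** Cramer's rule: the entries of the inverse are rational functions of the
    entries, with the determinant as denominator. *)
Lemma continuous_invmx (T : topologicalType) n (A : T -> 'M[R]_n) t :
  (forall x, A x \in unitmx) -> {for t, continuous A} ->
  {for t, continuous (fun x => invmx (A x))}.
Proof.
move=> Au Ac; apply: continuous_mx => i j.
have Aij k l := continuous_mx_entry (i := k) (j := l) Ac.
rewrite (_ : (fun x => _) = fun x => (\det (A x))^-1 * cofactor (A x) j i); last first.
  by apply/funext => x; rewrite /invmx Au !mxE.
apply: cvgM.
  apply: cvgV; last exact: continuous_det.
  by have := Au t; rewrite unitmxE unitfE.
apply: cvgM; first exact: cvg_cst.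
apply: (@continuous_det _ _ (fun x => row' j (col' i (A x)))) => k l.
rewrite (_ : (fun x => _) = fun x => A x (lift j k) (lift i l)) //.
by apply/funext => x; rewrite !mxE.
Qed.

End matrix_continuity.

(** * Real powers and Hoelder seminorms *)

Lemma ler_powR_base (R : realType) (h k p : R) : 0 <= h -> h <= k -> 0 <= p ->
  h `^ p <= k `^ p.
Proof. by move=> h0 hk p0; rewrite ge0_ler_powR// nnegrE (le_trans h0). Qed.

(** This is where a regularity above 1/3 enters: with p = 3 alpha it makes the
    dyadic recursion of the sewing estimate contracting. *)
Lemma half_powR_lt (R : realType) (p : R) : 1 < p -> 2 * 2^-1 `^ p < 1.
Proof.
move=> p1; have -> : p = (p - 1) + 1 by ring.
rewrite powRD; last by rewrite invr_eq0 pnatr_eq0 implybT.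
rewrite powRr1// mulrCA divff ?pnatr_eq0// mulr1.
have : 2^-1 `^ (p - 1) < 1 `^ (p - 1) :> R.
  by rewrite gt0_ltr_powR ?nnegrE ?subr_gt0//; lra.
by rewrite powR1.
Qed.

(** A finite Hoelder seminorm as an optimal real constant. The last clause, which
    replaces the supremum by any admissible bound, is what turns pointwise
    estimates into the inequalities between seminorms that are absorbed below. *)
Lemma holder2P (R : realType) (E : normedModType R) (beta a b : R)
    (A : R -> R -> E) : a < b -> (holder2 beta a b A < +oo)%E ->
  exists N, [/\ 0 <= N, holder2 beta a b A = N%:E,
    forall s t, a <= s -> s < t -> t <= b -> `|A s t| <= N * (t - s) `^ beta &
    forall K, (forall s t, a <= s -> s < t -> t <= b ->
      `|A s t| <= K * (t - s) `^ beta) -> N <= K].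
Proof.
move=> ab Afin.
have A0 : (0 <= holder2 beta a b A)%E.
  apply: ereal_sup_ge; exists (`|A a b| / (b - a) `^ beta)%:E.
    by exists a, b; split.
  by rewrite lee_fin divr_ge0// powR_ge0.
have Anum : holder2 beta a b A \is a fin_num by rewrite ge0_fin_numE.
exists (fine (holder2 beta a b A)); split.
- exact: fine_ge0.
- by rewrite fineK.
- move=> s t as_ st tb; rewrite -ler_pdivrMr ?powR_gt0 ?subr_gt0//.
  rewrite -lee_fin fineK//; apply: ereal_sup_ubound; by exists s, t; split.
- move=> K AK; rewrite -lee_fin fineK//; apply: ge_ereal_sup.
  move=> _ [s [t [as_ st tb ->]]].
  by rewrite lee_fin ler_pdivrMr ?powR_gt0 ?subr_gt0// AK.
Qed.

(** * Sewing along dyadic partitions *)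

Section sewing.
Context {R : realType} {E : normedModType R}.
Implicit Types (A : R -> R -> E) (J : E) (s t a b u : R) (p q : seq R).

(** The notion of limit in [is_rough_integral], for an arbitrary germ with values
    in a normed space; the two are convertible on rough germs. *)
Definition germ_limit A s t J : Prop :=
  forall eps, 0 < eps -> exists2 delta, 0 < delta &
    forall p, itv_partition s t p -> mesh_lt s t p delta ->
      `|germ_sum A s t p - J| < eps.

Lemma germ_sum_nil A s t : germ_sum A s t [::] = 0.
Proof. by rewrite /germ_sum big_nil. Qed.

Lemma germ_sum_cons A s t u p :
  germ_sum A s t (u :: p) = A s u + germ_sum A u t p.
Proof. by rewrite /germ_sum big_nat_recl. Qed.

Lemma germ_sum_cat A s t u p q : last s p = u ->
  germ_sum A s t (p ++ q) = germ_sum A s u p + germ_sum A u t q.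
Proof.
elim: p s => [|x p ih] s /=; first by move=> ->; rewrite germ_sum_nil add0r.
by move=> pu; rewrite !germ_sum_cons ih// addrA.
Qed.

Lemma mesh_lt_cons s t u p delta : mesh_lt s t (u :: p) delta <->
  u - s < delta /\ mesh_lt u t p delta.
Proof.
split=> [H|[us H] [|i]//= ip]; last exact: H.
by split=> [|i ip]; [exact: (H 0%N)|exact: (H i.+1)].
Qed.

Lemma mesh_lt_cat s t u p q delta : last s p = u ->
  mesh_lt s u p delta -> mesh_lt u t q delta -> mesh_lt s t (p ++ q) delta.
Proof.
elim: p s => [|x p ih] s /=; first by move=> ->.
by move=> pu /mesh_lt_cons[xs pd] qd; apply/mesh_lt_cons; split => //; apply: ih.
Qed.

Fixpoint dyadic (n : nat) s t : seq R :=
  if n is n'.+1 then dyadic n' s ((s + t) / 2) ++ dyadic n' ((s + t) / 2) t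
  else [:: t].

Lemma last_dyadic n s t : last s (dyadic n s t) = t.
Proof. by elim: n s t => //= n ih s t; rewrite last_cat !ih. Qed.

Lemma dyadic_partition n s t : s < t -> itv_partition s t (dyadic n s t).
Proof.
elim: n s t => [|n ih] s t st /=; first exact: itv_partition1.
by apply: (@itv_partition_cat _ _ _ ((s + t) / 2)); apply: ih; lra.
Qed.

Lemma dyadic_mesh n s t delta : (t - s) / 2 ^+ n < delta ->
  mesh_lt s t (dyadic n s t) delta.
Proof.
elim: n s t => [|n ih] s t /=.
  by rewrite divr1 => ts; apply/mesh_lt_cons.
rewrite exprS invfM mulrA => H.
apply: mesh_lt_cat (last_dyadic _ _ _) _ _; apply: ih.
  by apply: le_lt_trans H; rewrite ler_wpM2r// ?invr_ge0 ?exprn_ge0//; lra.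
by apply: le_lt_trans H; rewrite ler_wpM2r// ?invr_ge0 ?exprn_ge0//; lra.
Qed.

Lemma dyadic_mesh_exists s t delta : 0 < delta ->
  exists n, mesh_lt s t (dyadic n s t) delta.
Proof.
move=> d0; exists (Num.truncn (`|t - s| / delta)).+1.
apply: dyadic_mesh; set n := (Num.truncn _).+1.
rewrite ltr_pdivrMr ?exprn_gt0// -ltr_pdivrMl// mulrC.
apply: (@le_lt_trans _ _ (`|t - s| / delta)).
  by rewrite ler_wpM2r ?invr_ge0 ?(ltW d0)// ler_norm.
apply: (@lt_trans _ _ n%:R); first exact: truncnS_gt.
by rewrite -natrX ltr_nat ltn_expl.
Qed.

Lemma small_partition_exists s t delta : s <= t -> 0 < delta ->
  exists2 p, itv_partition s t p & mesh_lt s t p delta.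
Proof.
rewrite le_eqVlt => /predU1P[->|st] d0.
  by exists [::].
have [n nd] := dyadic_mesh_exists s t d0.
by exists (dyadic n s t) => //; apply: dyadic_partition.
Qed.

(** Additivity of the integral: a fine partition of [s, u] completes any fine
    partition of [u, t] to one of [s, t]. *)
Lemma germ_limit_split A s u t J J' : s <= u -> u < t ->
  germ_limit A s u J -> germ_limit A s t J' -> germ_limit A u t (J' - J).
Proof.
move=> su ut AJ AJ' eps e0.
have e20 : 0 < eps / 2 by rewrite divr_gt0.
have [d d0 dJ] := AJ _ e20; have [d' d'0 dJ'] := AJ' _ e20.
exists d' => // q qut qd'.
have [p pp pm] : exists2 p, itv_partition s u p &
    mesh_lt s u p (Num.min d d').
  by apply: small_partition_exists => //; rewrite lt_min d0.
have pd : mesh_lt s u p d by move=> i /pm; rewrite lt_min => /andP[].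
have pd' : mesh_lt s u p d' by move=> i /pm; rewrite lt_min => /andP[].
have pu : last s p = u by case: pp => _ /eqP.
have := dJ' (p ++ q) (itv_partition_cat pp qut) (mesh_lt_cat pu pd' qd').
have := dJ p pp pd.
rewrite (germ_sum_cat _ _ _ pu).
set G := germ_sum A s u p; set G' := germ_sum A u t q => H1 H2.
have -> : G' - (J' - J) = (G + G' - J') - (G - J).
  by rewrite !opprB [J - G]addrC (addrC G) addrACA addrK (addrC J).
by rewrite (le_lt_trans (ler_normB _ _))// [eps]splitr ltrD.
Qed.

(** Refining by one level splits [s, t] at its midpoint. The two halves
    contribute L (t - s)^theta 2^(- theta) each by induction and the defect at
    the midpoint contributes K (t - s)^theta; the hypothesis on L says that the
    total does not exceed L (t - s)^theta, so that one constant serves at all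
    levels. *)
Lemma dyadic_germ_sum_bound A a b theta K L : 0 <= L ->
  (forall s u t, a <= s -> s < u -> u < t -> t <= b ->
     `|A s t - A s u - A u t| <= K * (t - s) `^ theta) ->
  K + 2 * 2^-1 `^ theta * L <= L ->
  forall n s t, a <= s -> s < t -> t <= b ->
    `|germ_sum A s t (dyadic n s t) - A s t| <= L * (t - s) `^ theta.
Proof.
move=> L0 AK KL; elim=> [|n ih] s t as_ st tb /=.
  by rewrite germ_sum_cons germ_sum_nil addr0 subrr normr0 mulr_ge0// powR_ge0.
rewrite (germ_sum_cat _ _ _ (last_dyadic _ _ _)).
set m := (s + t) / 2.
have sm : s < m by rewrite /m; lra.
have mt : m < t by rewrite /m; lra.
have powm : ((t - s) / 2) `^ theta = (t - s) `^ theta * 2^-1 `^ theta.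
  by rewrite powRM ?subr_ge0 ?ltW.
have ih1 := ih s m as_ sm (ltW (lt_le_trans mt tb)).
have ih2 := ih m t (le_trans as_ (ltW sm)) mt tb.
rewrite (_ : m - s = (t - s) / 2) in ih1; last by rewrite /m; lra.
rewrite (_ : t - m = (t - s) / 2) in ih2; last by rewrite /m; lra.
have AKm := AK s m t as_ sm mt tb.
rewrite powm in ih1 ih2.
set G1 := germ_sum _ _ _ _ in ih1 *; set G2 := germ_sum _ _ _ _ in ih2 *.
have -> : G1 + G2 - A s t =
    (G1 - A s m) + (G2 - A m t) - (A s t - A s m - A m t).
  by rewrite [X in _ = X - _]addrACA -opprD -[A s t - _ - _]addrA -opprD opprB addrA subrK.
rewrite (le_trans (ler_normB _ _))//.
rewrite (le_trans (lerD (ler_normD _ _) (lexx _)))//.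
have T0 : 0 <= (t - s) `^ theta by exact: powR_ge0.
have := ler_wpM2r T0 KL.
set T := (t - s) `^ theta in T0 ih1 ih2 AKm *.
set h := 2^-1 `^ theta in ih1 ih2 *.
lra.
Qed.

Lemma germ_limit_bound A a b theta K L J s t : 0 <= L ->
  (forall s u t, a <= s -> s < u -> u < t -> t <= b ->
     `|A s t - A s u - A u t| <= K * (t - s) `^ theta) ->
  K + 2 * 2^-1 `^ theta * L <= L ->
  a <= s -> s < t -> t <= b ->
  germ_limit A s t J -> `|J - A s t| <= L * (t - s) `^ theta.
Proof.
move=> L0 AK KL as_ st tb AJ; apply/ler_addgt0Pr => e e0.
have [d d0 dJ] := AJ _ e0.
have [n nd] := dyadic_mesh_exists s t d0.
have := dJ _ (dyadic_partition n st) nd.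
have := dyadic_germ_sum_bound L0 AK KL n as_ st tb.
rewrite [X in _ -> X < _ -> _]distrC.
set G := germ_sum _ _ _ _ => H1 H2.
rewrite -(subrKA G) (le_trans (ler_normD _ _))// addrC.
by rewrite lerD// ltW.
Qed.

End sewing.

(** * Drift and germ of the linear equation *)

Lemma continuous_integrable_itv (R : realType) (f : R -> R) a b : continuous f ->
  lebesgue_measure.-integrable `[a, b] (EFin \o f).
Proof.
move=> fc; apply: continuous_compact_integrable; first exact: segment_compact.
exact: continuous_subspaceT.
Qed.

Section drift.
Context {R : realType} {D : nat}.
Variables (B0 : 'M[R]_D) (Y : R -> 'cV[R]_D).

Let continuous_drift i : continuous Y ->
  continuous (fun r => (B0 *m Y r) i 0).
Proof.
move=> Yc r; apply: (@continuous_mx_entry _ _ _ _ (fun r => B0 *m Y r)).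
by apply: continuous_mulmx; [exact: cvg_cst|exact: Yc].
Qed.

Lemma drift_integralB a s t : continuous Y -> a <= s -> s <= t ->
  drift_integral B0 Y a t - drift_integral B0 Y a s = drift_integral B0 Y s t.
Proof.
move=> Yc as_ st; apply/matrixP => i j; rewrite !mxE.
have fc := continuous_drift (i := i) Yc.
rewrite Rintegral_itvB ?bnd_simp//; last exact: continuous_integrable_itv.
apply: Rintegral_itv_obnd_cbnd.
apply: integrableS (continuous_integrable_itv _ _ fc) => //.
by apply: subset_itv; rewrite bnd_simp.
Qed.

Lemma normr_drift_integral s t S : continuous Y -> s <= t ->
  (forall r, s <= r <= t -> `|Y r| <= S) ->
  `|drift_integral B0 Y s t| <= D%:R * `|B0| * S * (t - s).
Proof.
move=> Yc st YS.
have S0 : 0 <= S by rewrite (le_trans _ (YS s _)) ?lexx.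
apply: normr_mx_le => [|i j]; first by rewrite !mulr_ge0 ?subr_ge0.
rewrite mxE.
have fc := continuous_drift (i := i) Yc.
have mst : measurable `[s, t]%classic by [].
rewrite (le_trans (le_normr_Rintegral _ _))//; first exact: continuous_integrable_itv.
rewrite (@le_trans _ _ (\int[lebesgue_measure]_(r in `[s, t])
   (D%:R * `|B0| * S)))//.
  apply: le_Rintegral => //.
  - apply: (continuous_integrable_itv (f := fun r => `|(B0 *m Y r) i 0|)).
    by move=> r; apply: cvg_norm; apply: fc.
  - by apply: continuous_integrable_itv => r; exact: cvg_cst.
  - move=> r /=; rewrite in_itv /= => /YS YrS.
    rewrite (le_trans (normr_mx_entry _ _ _))// (le_trans (normr_mulmx _ _))//.
    by rewrite ler_wpM2l// mulr_ge0.
rewrite Rintegral_cst// ler_wpM2l ?mulr_ge0//.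
have : fine (lebesgue_measure (`[s, t]%classic : set R)) <= t - s.
  rewrite lebesgue_measure_itv /= lte_fin; case: ltP => // _.
  by rewrite subr_ge0.
exact.
Qed.

End drift.

Section second_order.
Context {R : realType} {M D : nat}.
Implicit Types (V : 'M[R]_M) (Z : 'I_M -> 'M[R]_(D, M)).

(** The contraction of the second level with a Gubinelli derivative in
    [rough_germ], isolated to use its bilinearity. *)
Definition second_order_term V Z : 'cV[R]_D :=
  \sum_(k < M) \sum_(l < M) V k l *: col l (Z k).

Lemma second_order_termDl V1 V2 Z : second_order_term (V1 + V2) Z =
  second_order_term V1 Z + second_order_term V2 Z.
Proof.
rewrite -big_split; apply: eq_bigr => k _; rewrite -big_split.
by apply: eq_bigr => l _; rewrite mxE scalerDl.
Qed.

Lemma second_order_termBr V Z1 Z2 :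
  second_order_term V (fun k => Z1 k - Z2 k) =
  second_order_term V Z1 - second_order_term V Z2.
Proof.
rewrite -sumrB; apply: eq_bigr => k _; rewrite -sumrB.
by apply: eq_bigr => l _; rewrite linearB scalerBr.
Qed.

Lemma second_order_term_tensor (u v : 'cV[R]_M) Z :
  second_order_term (tensor u v) Z = (\sum_(k < M) u k 0 *: Z k) *m v.
Proof.
rewrite mulmx_suml; apply: eq_bigr => k _.
apply/matrixP => i j; rewrite ord1 summxE !mxE; apply: eq_bigr => l _.
by rewrite !mxE big_ord1 !mxE; ring.
Qed.

Lemma normr_second_order_term V Z c : (forall k, `|Z k| <= c) ->
  `|second_order_term V Z| <= M%:R * M%:R * `|V| * c.
Proof.
move=> Zc; rewrite (le_trans (ler_norm_sum _ _ _))//.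
rewrite -!mulrA mulr_natl -[X in _ *+ X]card_ord -sumr_const ler_sum// => k _.
rewrite (le_trans (ler_norm_sum _ _ _))//.
rewrite mulr_natl -[X in _ *+ X]card_ord -sumr_const ler_sum// => l _.
by rewrite normrZ ler_pM ?normr_mx_entry// (le_trans (normr_col _ _)).
Qed.

End second_order.

Section germ_defect.
Context {R : realType} {M D : nat}.
Variables (B : {linear 'cV[R]_D -> 'M[R]_(D, M)}) (W : two_level_path R M).
Variables (Y : R -> 'cV[R]_D).

Definition rde_germ : R -> R -> 'cV[R]_D :=
  rough_germ W (fun u => B (Y u)) (fun u k => B (rde_deriv B Y u k)).

Definition rde_remainder (s t : R) : 'cV[R]_D :=
  incr Y s t - \sum_(k < M) incr (level1 W) s t k 0 *: rde_deriv B Y s k.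

Lemma rde_germE s t : rde_germ s t = B (Y s) *m incr (level1 W) s t +
  second_order_term (level2 W s t) (fun k => B (rde_deriv B Y s k)).
Proof. by []. Qed.

Lemma sum_rde_deriv s (w : 'cV[R]_M) :
  \sum_(k < M) w k 0 *: rde_deriv B Y s k = B (Y s) *m w.
Proof.
apply/matrixP => i j; rewrite ord1 summxE mxE.
by apply: eq_bigr => k _; rewrite !mxE mulrC.
Qed.

(** The compensation by the second level is designed for this cancellation:
    Chen's relation turns the second-level defect into Z'_s W_(s,u) applied to
    W_(u,t), which completes the increment of Z = B Y to the value of B at the
    remainder of Y. *)
Lemma rde_germ_defect s u t :
  tensor (incr (level1 W) s u) (incr (level1 W) u t) =
    level2 W s t - level2 W s u - level2 W u t ->
  rde_germ s t - rde_germ s u - rde_germ u t =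
  - (B (rde_remainder s u) *m incr (level1 W) u t +
     second_order_term (level2 W u t)
       (fun k => B (rde_deriv B Y u k) - B (rde_deriv B Y s k))).
Proof.
move=> chen.
have -> : rde_germ s t = B (Y s) *m (incr (level1 W) s u + incr (level1 W) u t)
   + second_order_term (tensor (incr (level1 W) s u) (incr (level1 W) u t)
       + level2 W s u + level2 W u t) (fun k => B (rde_deriv B Y s k)).
  rewrite chen [_ - _ - _ + _]addrAC !subrK rde_germE; congr (_ *m _ + _).
  by rewrite /incr [RHS]addrC addrA subrK.
rewrite !rde_germE second_order_termBr !second_order_termDl.
rewrite second_order_term_tensor mulmxDr.
rewrite /rde_remainder !raddfB raddf_sum /=.
under [in RHS]eq_bigr do rewrite linearZ /=.
set Q := \sum_(k < M) _; rewrite !mulmxBl.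
apply/matrixP => i j; rewrite !mxE; ring.
Qed.

End germ_defect.

(** * A priori estimate on short intervals *)

Section remainder.
Context {R : realType} {M D : nat} (alpha : R).
Hypothesis alpha0 : 0 <= alpha.
Variables (B0 : 'M[R]_D) (B : {linear 'cV[R]_D -> 'M[R]_(D, M)}) (c : R).
Hypothesis c0 : 0 <= c.
Hypothesis normB : forall v, `|B v| <= c * `|v|.
Variables (W : two_level_path R M) (Y : R -> 'cV[R]_D) (a b : R).
Variables (w1 w2 NR NY : R).
Hypothesis w1_ge0 : 0 <= w1.
Hypothesis w2_ge0 : 0 <= w2.
Hypothesis NR_ge0 : 0 <= NR.
Hypothesis NY_ge0 : 0 <= NY.
Hypothesis chen : forall s u t, a <= s -> s < u -> u < t -> t <= b ->
  tensor (incr (level1 W) s u) (incr (level1 W) u t) =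
  level2 W s t - level2 W s u - level2 W u t.
Hypothesis boundW1 : forall s t, a <= s -> s < t -> t <= b ->
  `|incr (level1 W) s t| <= w1 * (t - s) `^ alpha.
Hypothesis boundW2 : forall s t, a <= s -> s < t -> t <= b ->
  `|level2 W s t| <= w2 * (t - s) `^ (2 * alpha).
Hypothesis boundY : forall s t, a <= s -> s < t -> t <= b ->
  `|incr Y s t| <= NY * (t - s) `^ alpha.
Hypothesis boundR : forall s t, a <= s -> s < t -> t <= b ->
  `|rde_remainder B W Y s t| <= NR * (t - s) `^ (2 * alpha).

Lemma normr_rde_deriv s k : `|rde_deriv B Y s k| <= c * `|Y s|.
Proof. exact: le_trans (normr_col _ _) (normB _). Qed.

(** Both terms of the defect are products of a factor of order 2 alpha and a
    factor of order alpha, hence of order 3 alpha. *)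
Lemma rde_germ_defect_bound s u t : a <= s -> s < u -> u < t -> t <= b ->
  `|rde_germ B W Y s t - rde_germ B W Y s u - rde_germ B W Y u t| <=
  (M%:R * c * NR * w1 + M%:R * M%:R * c ^+ 2 * w2 * NY) * (t - s) `^ (3 * alpha).
Proof.
move=> as_ su ut tb.
have st := lt_trans su ut.
have a2 : 0 <= 2 * alpha by rewrite mulr_ge0.
have T3 : (t - s) `^ (3 * alpha) = (t - s) `^ (2 * alpha) * (t - s) `^ alpha.
  rewrite -powRD; last by rewrite subr_eq0 (gt_eqF st) implybT.
  by congr powR; ring.
have p1 p : 0 <= p -> (u - s) `^ p <= (t - s) `^ p.
  by move=> p0; apply: ler_powR_base => //; lra.
have p2 p : 0 <= p -> (t - u) `^ p <= (t - s) `^ p.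
  by move=> p0; apply: ler_powR_base => //; lra.
rewrite rde_germ_defect; last exact: chen.
rewrite normrN (le_trans (ler_normD _ _))// mulrDl lerD//.
  rewrite (le_trans (normr_mulmx _ _))//.
  have -> : M%:R * c * NR * w1 * (t - s) `^ (3 * alpha) =
      M%:R * (c * (NR * (t - s) `^ (2 * alpha))) * (w1 * (t - s) `^ alpha).
    by rewrite T3; ring.
  rewrite ler_pM//.
  - by rewrite ler_wpM2l// (le_trans (normB _))// ler_wpM2l//
      (le_trans (boundR as_ su (ltW (lt_le_trans ut tb))))// ler_wpM2l// p1.
  - by rewrite (le_trans (boundW1 (le_trans as_ (ltW su)) ut tb))// ler_wpM2l// p2.
rewrite (@le_trans _ _ (M%:R * M%:R * `|level2 W u t| * (c * (c * `|incr Y s u|))))//.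
  apply: normr_second_order_term => k; rewrite -raddfB (le_trans (normB _))//.
  rewrite ler_wpM2l// /rde_deriv -raddfB (le_trans (normr_col _ _))//.
  by rewrite -raddfB; exact: normB.
have -> : M%:R * M%:R * c ^+ 2 * w2 * NY * (t - s) `^ (3 * alpha) =
    M%:R * M%:R * (w2 * (t - s) `^ (2 * alpha)) *
      (c * (c * (NY * (t - s) `^ alpha))) by rewrite T3; ring.
rewrite ler_pM ?mulr_ge0//.
- by rewrite ler_wpM2l ?mulr_ge0//
    (le_trans (boundW2 (le_trans as_ (ltW su)) ut tb))// ler_wpM2l// p2.
- by rewrite !ler_wpM2l// (le_trans (boundY as_ su (ltW (lt_le_trans ut tb))))//
    ler_wpM2l// p1.
Qed.

Variables (S Lam : R).
Hypothesis Yc : continuous Y.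
Hypothesis boundS : forall r, a <= r <= b -> `|Y r| <= S.
Hypothesis Lam_ge0 : 0 <= Lam.
(* Lam is an admissible sewing constant for a defect constant equal to 1. *)
Hypothesis LamE : 1 + 2 * 2^-1 `^ (3 * alpha) * Lam <= Lam.
Hypothesis rde : forall s t, a <= s -> s < t -> t <= b ->
  exists2 J, germ_limit (rde_germ B W Y) s t J &
    Y t = Y s + drift_integral B0 Y s t + J.

Let K := M%:R * c * NR * w1 + M%:R * M%:R * c ^+ 2 * w2 * NY.

(** The remainder is the drift plus the sewing error J - A s t plus the
    second-order part of the germ. The sewing error involves the seminorms NR
    and NY of the solution itself, but carries the higher power 3 alpha. *)
Lemma rde_remainder_bound s t : a <= s -> s < t -> t <= b ->
  `|rde_remainder B W Y s t| <= D%:R * `|B0| * S * (t - s)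
    + Lam * K * (t - s) `^ (3 * alpha)
    + M%:R * M%:R * c ^+ 2 * w2 * S * (t - s) `^ (2 * alpha).
Proof.
move=> as_ st tb; have [J AJ YJ] := rde as_ st tb.
have K0 : 0 <= K by rewrite /K addr_ge0// !mulr_ge0// exprn_ge0.
have S0 : 0 <= S.
  by rewrite (le_trans _ (boundS (r := s) _))// as_ (le_trans (ltW st)).
have -> : rde_remainder B W Y s t = drift_integral B0 Y s t +
    (J - rde_germ B W Y s t) +
    second_order_term (level2 W s t) (fun k => B (rde_deriv B Y s k)).
  rewrite /rde_remainder sum_rde_deriv rde_germE {1}/incr YJ.
  apply/matrixP => i j; rewrite !mxE; ring.
rewrite (le_trans (ler_normD _ _))// lerD//.
  rewrite (le_trans (ler_normD _ _))// lerD//.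
    apply: normr_drift_integral => //; first exact: ltW.
    move=> r /andP[sr rt].
    by apply: boundS; rewrite (le_trans as_ sr) (le_trans rt tb).
  apply: (germ_limit_bound (a := a) (b := b) (K := K)) => //.
  - exact: mulr_ge0.
  - exact: rde_germ_defect_bound.
  - by have := ler_wpM2r K0 LamE; rewrite mulrDl mul1r mulrA.
apply: (@le_trans _ _ (M%:R * M%:R * `|level2 W s t| * (c * (c * S)))).
  apply: normr_second_order_term => k; rewrite (le_trans (normB _))// ler_wpM2l//.
  rewrite (le_trans (normr_rde_deriv _ _))// ler_wpM2l// boundS//.
  by rewrite as_ (le_trans (ltW st)).
have -> : M%:R * M%:R * c ^+ 2 * w2 * S * (t - s) `^ (2 * alpha) =
  M%:R * M%:R * (w2 * (t - s) `^ (2 * alpha)) * (c * (c * S)) by ring.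
by rewrite ler_wpM2r ?mulr_ge0// ler_wpM2l ?mulr_ge0// boundW2.
Qed.

End remainder.

(** The closing step of the a priori estimate. Here v is |Y a|, and x, y are the
    seminorms of the remainder and of the path, scaled by the powers h^(2 alpha)
    and h^alpha of the length h of the interval, so that v + y bounds |Y|. With
    a coefficient d at most 1/16 the unknowns on the right are absorbed:
    15 x <= v + 2 y and 15 y <= 16 x + v give 193 y <= 31 v. *)
Lemma absorb_increment (R : realFieldType) (e1 e2 e3 L eta x y v : R) :
  0 <= e1 -> 0 <= e2 -> 0 <= e3 -> 0 <= L -> 0 <= eta ->
  0 <= x -> 0 <= y -> 0 <= v ->
  (e1 + e2 + e3 + L * (e2 + e3) + 1) * eta <= 16^-1 ->
  x <= (e1 * (v + y) + L * (e2 * x + e3 * y) + e3 * (v + y)) * eta ->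
  y <= x + e2 * (v + y) * eta -> y <= v / 2.
Proof.
move=> e10 e20 e30 L0 eta0 x0 y0 v0; set d := (_ * eta) => d16 xle yle.
have {xle} xle : x <= d * (v + 2 * y + x).
  rewrite (le_trans xle)// -subr_ge0.
  have -> : d * (v + 2 * y + x) -
      (e1 * (v + y) + L * (e2 * x + e3 * y) + e3 * (v + y)) * eta =
    eta * (e1 * (x + y) + e2 * (v + y + x + y) + e3 * (x + y)
           + L * (e2 * (v + y + y) + e3 * (v + y + x)) + (v + y + x + y)).
    by rewrite /d; ring.
  by rewrite mulr_ge0// !addr_ge0// mulr_ge0// !addr_ge0// mulr_ge0// !addr_ge0.
have {yle} yle : y <= x + d * (v + y).
  rewrite (le_trans yle)// lerD2l mulrAC ler_wpM2r ?addr_ge0// ler_wpM2r//.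
  have : 0 <= L * (e2 + e3) by rewrite mulr_ge0// addr_ge0.
  lra.
(* d may be replaced by 1/16 because it multiplies nonnegative quantities;
   linear arithmetic then concludes. *)
have A : d * (v + 2 * y + x) <= 16^-1 * (v + 2 * y + x) by rewrite ler_wpM2r//; lra.
have B : d * (v + y) <= 16^-1 * (v + y) by rewrite ler_wpM2r//; lra.
lra.
Qed.

(** The threshold eps depends on alpha and on the coefficients only, and the
    smallness condition is linear in the size of the driving path. Solved for
    the step length b - a, it allows steps of order (1 + |W|)^(-1/alpha); this is
    where the exponent 1/alpha of the integrability hypothesis comes from. *)
Lemma rde_local_increment (R : realType) (M D : nat) (alpha : R)
    (halpha : 3^-1 < alpha <= 2^-1) (B0 : 'M[R]_D)
    (B : {linear 'cV[R]_D -> 'M[R]_(D, M)}) :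
  exists2 eps, 0 < eps & forall (W : two_level_path R M) Y a b w1 w2,
    a < b -> b - a <= 1 -> 0 <= w1 -> 0 <= w2 ->
    (forall s u t, a <= s -> s < u -> u < t -> t <= b ->
      tensor (incr (level1 W) s u) (incr (level1 W) u t) =
      level2 W s t - level2 W s u - level2 W u t) ->
    (forall s t, a <= s -> s < t -> t <= b ->
      `|incr (level1 W) s t| <= w1 * (t - s) `^ alpha) ->
    (forall s t, a <= s -> s < t -> t <= b ->
      `|level2 W s t| <= w2 * (t - s) `^ (2 * alpha)) ->
    controlled_on alpha a b W Y (rde_deriv B Y) -> continuous Y ->
    (forall s t, a <= s -> s < t -> t <= b ->
      exists2 J, germ_limit (rde_germ B W Y) s t J &
        Y t = Y s + drift_integral B0 Y s t + J) ->
    (b - a) `^ alpha * (1 + w1 + w2) <= eps ->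
    forall t, a <= t <= b -> `|Y t - Y a| <= `|Y a| / 2.
Proof.
have /andP[al3 al2] := halpha.
have al0 : 0 < alpha by lra.
have al1 : 0 <= 1 - 2 * alpha by lra.
have al1' : alpha <= 1 by lra.
have [c c0 normB] := linear_cV_bounded B.
have k1 : 2 * 2^-1 `^ (3 * alpha) < 1 by apply: half_powR_lt; lra.
set k := 2 * _ in k1.
(* Sum of the geometric series of ratio k = 2^(1 - 3 alpha): the sewing
   constant for a defect constant equal to 1. *)
pose Lam := (1 - k)^-1.
have k10 : 0 < 1 - k by lra.
have Lam0 : 0 <= Lam by rewrite invr_ge0 ltW.
have LamE : 1 + k * Lam <= Lam.
  by rewrite -[leRHS]mul1r -lerBrDr -mulrBl divff ?gt_eqF.
(* Operator bounds of the drift, of the first-order and of the second-order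
   part of the germ, in the maximum norm. *)
pose e1 := D%:R * `|B0|; pose e2 := M%:R * c; pose e3 := M%:R * M%:R * c ^+ 2.
have e10 : 0 <= e1 by exact: mulr_ge0.
have e20 : 0 <= e2 by exact: mulr_ge0.
have e30 : 0 <= e3 by rewrite !mulr_ge0// exprn_ge0.
pose G := e1 + e2 + e3 + Lam * (e2 + e3) + 1.
have G1 : 1 <= G by rewrite /G lerDr !addr_ge0// mulr_ge0// addr_ge0.
exists (16 * G)^-1.
  by rewrite invr_gt0 mulr_gt0 ?(lt_le_trans _ G1).
move=> W Y a b w1 w2 ab ba1 w10 w20 chen W1 W2 YC Yc rde small t tab.
set h := b - a in ba1 small.
have h0 : 0 < h by rewrite subr_gt0.
have powh s r p : a <= s -> s < r -> r <= b -> 0 <= p -> (r - s) `^ p <= h `^ p.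
  by move=> as_ sr rb p0; rewrite ler_powR_base ?lerB// subr_ge0 ltW.
set q := h `^ alpha in small.
have q0 : 0 < q by exact: powR_gt0.
set eta := q * _ in small.
have eta0 : 0 <= eta by rewrite mulr_ge0// ?addr_ge0// ltW.
have d16 : G * eta <= 16^-1.
  have G0 : 0 < G by lra.
  apply: (le_trans (ler_wpM2l (ltW G0) small)).
  by rewrite invfM mulrCA divff ?gt_eqF// mulr1.
have eta1 : eta <= 1.
  have : 1 * eta <= G * eta by rewrite ler_wpM2r.
  lra.
(* The quantities through which the length and the seminorms of W enter the
   estimate; eta dominates each of them, the last one because q <= 1. *)
have qeta : q <= eta by rewrite /eta ler_peMr ?(ltW q0)//; lra.
have heta : h <= eta by rewrite (le_trans _ qeta)// ger1_powR// h0.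
have qw1 : q * w1 <= eta by rewrite ler_wpM2l ?(ltW q0)//; lra.
have qw2 : q ^+ 2 * w2 <= eta.
  rewrite (@le_trans _ _ (q * w2))//; last by rewrite ler_wpM2l ?(ltW q0)//; lra.
  by rewrite ler_wpM2r// expr2 ler_piMr ?(ltW q0)// (le_trans qeta).
have [NY [NY0 _ YY NYle]] := holder2P ab (controlled_path YC).
have [NR [NR0 _ YR NRle]] := holder2P ab (controlled_remainder YC).
pose v := `|Y a|; pose S := v + NY * q.
have v0 : 0 <= v by exact: normr_ge0.
have S0 : 0 <= S by rewrite addr_ge0// mulr_ge0// ltW.
have YqS r : a <= r <= b -> `|Y r - Y a| <= NY * q.
  case/andP; rewrite le_eqVlt => /predU1P[-> _|ar rb].
    by rewrite subrr normr0 mulr_ge0// ltW.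
  rewrite (le_trans (YY a r _ _ _))// ler_wpM2l//.
  by rewrite powh// ltW.
have YS r : a <= r <= b -> `|Y r| <= S.
  move=> /YqS H; rewrite -[Y r](subrK (Y a)) (le_trans (ler_normD _ _))//.
  by rewrite addrC lerD2l.
have RB := rde_remainder_bound (ltW al0) c0 normB w10 w20 NR0 NY0 chen W1 W2
  YY YR Yc YS Lam0 LamE rde.
set K := _ + _ in RB.
have h2 : h `^ (2 * alpha) = q ^+ 2.
  by rewrite mulrC powRrM powR_mulrn// powR_ge0.
have split3 r : 0 < r -> r `^ (3 * alpha) = r `^ (2 * alpha) * r `^ alpha.
  move=> r0; rewrite -powRD ?(gt_eqF r0) ?implybT//; congr powR; ring.
have K0 : 0 <= K by rewrite addr_ge0// !mulr_ge0// exprn_ge0.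
(* Dividing the remainder bound by (r - s)^(2 alpha), which leaves
   nonnegative powers of the length since 2 alpha <= 1. *)
have NRK : NR <= e1 * S * h `^ (1 - 2 * alpha) + Lam * K * q + e3 * w2 * S.
  apply: NRle => s r as_ sr rb.
  rewrite (le_trans (RB s r as_ sr rb))// (mulrDl (_ + _)) (mulrDl (e1 * S * _)).
  have rs0 : 0 < r - s by rewrite subr_gt0.
  rewrite lerD//; rewrite lerD//.
    rewrite -(mulrA (e1 * S)) ler_wpM2l//; first exact: mulr_ge0.
    have E : (r - s) `^ (1 - 2 * alpha) * (r - s) `^ (2 * alpha) = r - s.
      by rewrite -powRD ?(gt_eqF rs0) ?implybT// subrK powRr1// ltW.
    rewrite -[X in X <= _]E.
    by rewrite ler_wpM2r ?powR_ge0// powh.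
  rewrite split3// -(mulrA (Lam * K)) ler_wpM2l ?mulr_ge0//.
  by rewrite mulrC ler_wpM2r ?powR_ge0// powh// ltW.
have NYR : NY <= NR * q + e2 * S * w1.
  apply: NYle => s r as_ sr rb.
  have -> : incr Y s r = rde_remainder B W Y s r + B (Y s) *m incr (level1 W) s r.
    by rewrite /rde_remainder sum_rde_deriv subrK.
  rewrite (le_trans (ler_normD _ _))// mulrDl lerD//.
    rewrite (le_trans (YR s r as_ sr rb))// -mulrA ler_wpM2l//.
    have -> : 2 * alpha = alpha + alpha by ring.
    rewrite powRD ?subr_eq0 ?(gt_eqF sr) ?implybT// ler_wpM2r ?powR_ge0//.
    by rewrite powh// ltW.
  rewrite (le_trans (normr_mulmx _ _))//.
  have -> : e2 * S * w1 * (r - s) `^ alpha =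
      M%:R * (c * S) * (w1 * (r - s) `^ alpha) by rewrite /e2; ring.
  rewrite ler_pM ?mulr_ge0//; last exact: W1.
  rewrite ler_wpM2l// (le_trans (normB _))// ler_wpM2l// YS//.
  by rewrite as_ (le_trans (ltW sr)).
pose x := q ^+ 2 * NR; pose y := q * NY.
have x0 : 0 <= x by rewrite mulr_ge0// exprn_ge0// ltW.
have y0 : 0 <= y by rewrite mulr_ge0// ltW.
have SE : S = v + y by rewrite /S /y mulrC.
have xle : x <= e1 * S * h + Lam * (e2 * x * (q * w1) + e3 * y * (q ^+ 2 * w2))
    + e3 * S * (q ^+ 2 * w2).
  have q20 : 0 <= q ^+ 2 by rewrite exprn_ge0// ltW.
  rewrite (le_trans (ler_wpM2l q20 NRK))//.
  have {2}<- : h `^ (1 - 2 * alpha) * q ^+ 2 = h.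
    rewrite -h2 -powRD ?(gt_eqF h0) ?implybT// subrK powRr1// ltW//.
  by rewrite le_eqVlt; apply/orP; left; apply/eqP; rewrite /x /y /e2 /e3 /K; ring.
have yle : y <= x + e2 * S * (q * w1).
  rewrite (le_trans (ler_wpM2l (ltW q0) NYR))//.
  by rewrite le_eqVlt; apply/orP; left; apply/eqP; rewrite /x; ring.
have yv2 : y <= v / 2.
  apply: (@absorb_increment _ e1 e2 e3 Lam eta x) => //; rewrite -SE.
    rewrite (le_trans xle)// 2!mulrDl -(mulrA Lam) (mulrDl (e2 * x)).
    apply: lerD; [apply: lerD|].
    - by apply: ler_wpM2l heta; exact: mulr_ge0.
    - by apply: ler_wpM2l => //; apply: lerD; apply: ler_wpM2l => //; exact: mulr_ge0.
    - by apply: ler_wpM2l qw2; exact: mulr_ge0.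
  by rewrite (le_trans yle)// lerD2l ler_wpM2l ?mulr_ge0.
rewrite (le_trans (YqS t tab))//.
by rewrite mulrC.
Qed.

(** * Growth on the unit interval *)

Section growth.
Context {R : realType} {M D : nat} (alpha : R).
Variables (B0 : 'M[R]_D) (B : {linear 'cV[R]_D -> 'M[R]_(D, M)}).

(** The equation is given from time 0; additivity of the drift and of the rough
    integral restarts it at any time s. *)
Lemma rde_solution_increment (W : two_level_path R M) Y s t :
  rde_solution alpha B0 B W Y -> continuous Y -> 0 <= s -> s < t ->
  exists2 J, germ_limit (rde_germ B W Y) s t J &
    Y t = Y s + drift_integral B0 Y s t + J.
Proof.
move=> sol Yc s0 st.
have [Js JsP YsE] := rde_forward sol s0.
have [Jt JtP YtE] := rde_forward sol (le_trans s0 (ltW st)).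
exists (Jt - Js); first exact: germ_limit_split s0 st JsP JtP.
rewrite -(drift_integralB B0 Yc s0 (ltW st)) YsE YtE.
by apply/matrixP => i j; rewrite !mxE; ring.
Qed.

(** An increment of at most half the norm can neither more than double the norm
    nor less than halve it; the second bound is what controls the inverse. *)
Lemma doubling_chain (E : normedModType R) (y : nat -> E) n :
  (forall k, (k < n)%N -> `|y k.+1 - y k| <= `|y k| / 2) ->
  `|y n| <= 2 ^+ n * `|y 0%N| /\ `|y 0%N| <= 2 ^+ n * `|y n|.
Proof.
elim: n => [|n ih] yP; first by rewrite expr0 !mul1r.
have [up lo] := ih (fun k kn => yP k (ltnW kn)).
have step := yP n (ltnSn n).
have n0 : 0 <= (2 : R) ^+ n by rewrite exprn_ge0.
have yn0 : 0 <= `|y n| by [].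
have up1 : `|y n.+1| <= 2 * `|y n|.
  have := ler_normD (y n.+1 - y n) (y n); rewrite subrK; lra.
have lo1 : `|y n| <= 2 * `|y n.+1|.
  have := ler_normB (y n.+1) (y n.+1 - y n); rewrite opprB addrC subrK; lra.
rewrite exprSr -!mulrA; split.
  by rewrite (le_trans up1)// mulrCA ler_wpM2l.
by rewrite (le_trans lo)// ler_wpM2l.
Qed.

(** The number of equal steps of [0, 1] that makes each of them short enough is
    of order (1 + w)^(1/al), and 1 + w <= 2 max(1, w) separates the constant. *)
Lemma steps_enough (al e w : R) : 0 < al -> 0 < e -> 0 <= w ->
  exists n : nat, [/\ (0 < n)%N, n%:R^-1 `^ al * (1 + w) <= e &
    n%:R <= ((2 / e) `^ al^-1 + 1) * (1 + w `^ al^-1)].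
Proof.
move=> al0 e0 w0; pose X := ((1 + w) / e) `^ al^-1.
have X0 : 0 <= X by exact: powR_ge0.
have w10 : 0 <= (1 + w) / e by rewrite divr_ge0 ?addr_ge0// ltW.
exists (Num.truncn X).+1; split=> //.
  have XN : X <= (Num.truncn X).+1%:R by exact/ltW/truncnS_gt.
  set N := _.+1%:R in XN *.
  have N0 : 0 < N by rewrite /N ltr0n.
  have : (1 + w) / e <= N `^ al.
    have -> : (1 + w) / e = X `^ al.
      by rewrite /X -powRrM mulVf ?gt_eqF// powRr1.
    exact: ler_powR_base X0 XN (ltW al0).
  have -> : N^-1 `^ al = (N `^ al)^-1.
    by rewrite -(powR_inv1 (ltW N0)) -powRrM mulN1r powRN.
  by rewrite ler_pdivrMr// ler_pdivrMl ?powR_gt0.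
rewrite -natr1 mulrDl mul1r lerD ?lerDl ?powR_ge0//.
rewrite (le_trans (_ : _ <= X))//; first by have /andP[] := truncn_itv X0.
have C0 : 0 <= (2 / e) `^ al^-1 by exact: powR_ge0.
have iv : 0 <= al^-1 by rewrite invr_ge0 ltW.
have e'0 : 0 <= e^-1 by rewrite invr_ge0 ltW.
rewrite mulrDr mulr1; have [w1|w1] := leP w 1.
  rewrite (@le_trans _ _ ((2 / e) `^ al^-1))//; last by rewrite lerDl mulr_ge0// powR_ge0.
  by rewrite ler_powR_base// ler_wpM2r//; lra.
rewrite (@le_trans _ _ ((2 / e) `^ al^-1 * w `^ al^-1))//; last by rewrite lerDr.
have e20 : 0 <= 2 / e by rewrite mulr_ge0.
rewrite -(powRM _ e20 w0); apply: ler_powR_base => //.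
by rewrite mulrAC ler_wpM2r//; lra.
Qed.

(** The number n of steps depends on the driving path but not on the initial
    value, so that both bounds pass to operator norms. *)
Lemma rde_growth (halpha : 3^-1 < alpha <= 2^-1) :
  exists C, forall (W : two_level_path R M) w,
    rough_path_on alpha 0 1 W -> rough_norm alpha 0 1 W = w%:E ->
    exists2 n : nat, n%:R <= C * (1 + w `^ alpha^-1) &
      forall Y t, rde_solution alpha B0 B W Y -> continuous Y -> 0 <= t <= 1 ->
        `|Y t| <= 2 ^+ n * `|Y 0| /\ `|Y 0| <= 2 ^+ n * `|Y t|.
Proof.
have al0 : 0 < alpha by case/andP: halpha => al3 _; lra.
have [e e0 H] := rde_local_increment halpha B0 B.
exists ((2 / e) `^ alpha^-1 + 1).
move=> W w [fin1 fin2 chen] wE.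
have [w1 [w10 w1E W1 _]] := holder2P ltr01 fin1.
have [w2 [w20 w2E W2 _]] := holder2P ltr01 fin2.
have {wE} wE : w = w1 + w2.
  by apply/esym; case: wE; rewrite /rough_norm w1E w2E => -[].
have w0 : 0 <= w by rewrite wE addr_ge0.
have [n [n0 nsmall nle]] := steps_enough al0 e0 w0.
exists n => // Y t sol Yc /andP[t0 t1].
move: t0; rewrite le_eqVlt => /predU1P[<-|t0].
  by split; rewrite ler_peMl// exprn_ege1//; lra.
have N0 : 0 < n%:R :> R by rewrite ltr0n.
pose y k := Y (k%:R * (t / n%:R)).
have -> : Y t = y n by rewrite /y mulrCA divff ?gt_eqF// mulr1.
have -> : Y 0 = y 0%N by rewrite /y mul0r.
have h0 : 0 < t / n%:R by rewrite divr_gt0.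
have hn : t / n%:R <= n%:R^-1 by rewrite ler_piMl ?invr_ge0 ?(ltW N0).
apply: doubling_chain => k kn.
set a := k%:R * (t / n%:R); set b := k.+1%:R * (t / n%:R).
have ba : b - a = t / n%:R by rewrite /b /a -natr1; ring.
have ab : a < b by rewrite -subr_gt0 ba.
have a0 : 0 <= a by rewrite mulr_ge0// ltW.
have b1 : b <= 1.
  rewrite (le_trans _ t1)// /b mulrCA ler_piMr// ?(ltW t0)//.
  by rewrite ler_pdivrMr// mul1r ler_nat.
apply: (H W Y a b w1 w2) => //.
- rewrite ba (le_trans hn)// invf_le1// ler1n//.
- by move=> s u r as_ su ur rb; apply: chen => //; [exact: le_trans as_|exact: le_trans b1].
- by move=> s r as_ sr rb; apply: W1 => //; [exact: le_trans as_|exact: le_trans b1].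
- by move=> s r as_ sr rb; apply: W2 => //; [exact: le_trans as_|exact: le_trans b1].
- exact: (rde_controlled sol).
- move=> s r as_ sr rb; apply: rde_solution_increment => //; exact: le_trans as_.
- rewrite ba (le_trans _ nsmall)// -addrA -wE ler_wpM2r ?addr_ge0//.
  by apply: ler_powR_base => //; exact: ltW.
- by rewrite lexx ltW.
Qed.

End growth.

(** * Measurability of the supremum over time *)

Section log_plus.
Context {R : realType}.

(** This form shows the continuity, the logarithm being evaluated away from 0. *)
Lemma log_plusE (x : R) : log_plus x = ln (Num.max x 1).
Proof.
rewrite /log_plus; have [x1|x1] := leP x 1.
  by rewrite ln1; apply/max_idPr; exact: ln_le0.
by apply/max_idPl; rewrite ln_ge0// ltW.
Qed.

Lemma continuous_log_plus : continuous (@log_plus R).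
Proof.
move=> x; rewrite (_ : log_plus = fun y => ln (Num.max y 1)); last first.
  by apply/funext => y; exact: log_plusE.
have mx : {for x, continuous (fun y : R => Num.max y 1)}.
  by apply: (@continuous_max _ _ id (cst 1)) => //; exact: cst_continuous.
apply: (continuous_cvg _ _ mx); apply: continuous_ln.
by rewrite lt_max ltr01 orbT.
Qed.

Lemma log_plus_ge0 (x : R) : 0 <= log_plus x.
Proof. by rewrite le_max lexx orbT. Qed.

(** The crude bound 2 <= e spares a constant ln 2. *)
Lemma log_plus_pow2 (x : R) n : x <= 2 ^+ n -> log_plus x <= n%:R.
Proof.
move=> xn; rewrite log_plusE -[leRHS]expRK ler_ln ?posrE ?expR_gt0//; last first.
  by rewrite lt_max ltr01 orbT.
have e2 : 2 <= expR 1 :> R by exact: (le_trans _ (expR_ge1Dx 1)).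
rewrite ge_max; apply/andP; split.
  by rewrite (le_trans xn)// -[n%:R]mulr1 expRM_natl lerXn2r// nnegrE ?expR_ge0.
by rewrite -[leLHS]expR0 ler_expR.
Qed.

End log_plus.

Section measurability.
Context {R : realType} {d : measure_display} {T : measurableType d}.

Lemma measurable_bigmaxr (I : Type) (s : seq I) (f : I -> T -> R) :
  (forall i, measurable_fun setT (f i)) ->
  measurable_fun setT (fun x => \big[Num.max/0]_(i <- s) f i x).
Proof.
move=> mf; elim: s => [|i s ih].
  by under eq_fun do rewrite big_nil; exact: measurable_cst.
under eq_fun do rewrite big_cons.
exact: measurable_maxr.
Qed.

Lemma measurable_normr_mx m n (A : T -> 'M[R]_(m, n)) :
  (forall i j, measurable_fun setT (fun x => A x i j)) ->
  measurable_fun setT (fun x => `|A x|).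
Proof.
move=> mA.
rewrite (_ : (fun x => _) =
    fun x => \big[Num.max/0]_(ij : 'I_m * 'I_n) `|A x ij.1 ij.2|); last first.
  by apply/funext => x; rewrite [LHS]/Num.Def.normr /= mx_normrE.
apply: measurable_bigmaxr => ij.
by apply: measurableT_comp => //; exact: mA.
Qed.

(** Clipping the rationals to [0, 1] keeps them dense at the end points, with no
    case distinction there, because clipping is 1-Lipschitz. *)
Definition rat_in_unit_itv (k : nat) : R :=
  if unpickle k is Some q then Num.min 1 (Num.max 0 (ratr q)) else 0.

Lemma rat_in_unit_itvP k : 0 <= rat_in_unit_itv k <= 1.
Proof.
rewrite /rat_in_unit_itv; case: unpickle => [q|]; last by rewrite lexx ler01.
by rewrite le_min ler01 le_max lexx /= ge_min lexx.
Qed.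

Lemma rat_in_unit_itv_dense t e : 0 <= t <= 1 -> 0 < e ->
  exists k, `|t - rat_in_unit_itv k| < e.
Proof.
move=> /andP[t0 t1] e0.
have te : t - e < t + e by lra.
have [q] := rat_in_itvoo te.
rewrite in_itv /= => /andP[q1 q2].
exists (pickle q); rewrite /rat_in_unit_itv pickleK.
by case: (leP 0 (ratr q : R)) => ?; case: (leP 1 _) => ?; rewrite ltr_norml; lra.
Qed.

(** By continuity in time, the supremum over [0, 1] is the supremum over a
    sequence of times. *)
Lemma measurable_sup_unit_itv (g : R -> T -> R) :
  (forall t, measurable_fun setT (g t)) -> (forall x, continuous (g ^~ x)) ->
  measurable_fun setT (fun x => ereal_sup [set (g t x)%:E | t in `[0, 1]]).
Proof.
move=> mg gc.
rewrite (_ : (fun x => _) =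
    fun x => esups (fun k => (g (rat_in_unit_itv k) x)%:E) 0); last first.
  apply/funext => x; apply/le_anti/andP; split.
    apply: ge_ereal_sup => _ [t /= t01 <-]; rewrite in_itv /= in t01.
    apply/lee_addgt0Pr => e e0.
    have /cvgrPdist_lt/(_ _ e0)/nbhs_ballP[r /= r0 tr] := gc x t.
    have [k kr] := rat_in_unit_itv_dense t01 r0.
    have gk := tr _ kr.
    apply: (@le_trans _ _ ((g (rat_in_unit_itv k) x)%:E + e%:E)%E).
      by rewrite -EFinD lee_fin; move: gk; rewrite /= ltr_norml => /andP[_]; lra.
    by rewrite leeD2r//; apply: ereal_sup_ubound; exists k.
  apply: ge_ereal_sup => _ [k _ <-]; apply: ereal_sup_ubound.
  by exists (rat_in_unit_itv k) => //=; rewrite in_itv /= rat_in_unit_itvP.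
apply: measurable_fun_esups => k.
by apply/measurable_EFinP; exact: mg.
Qed.

End measurability.

(** * Integrability of the cocycle *)

(** Besides invertibility, the formula gives the measurability of the inverse in
    omega from that of the cocycle and of the flow. *)
Lemma linear_cocycle_inverse (R : realType) (d : measure_display)
    (Omega : measurableType d) (D : nat) (theta : R -> Omega -> Omega)
    (Phi : R -> Omega -> 'M[R]_D) t omega : linear_cocycle theta Phi ->
  Phi t omega \in unitmx /\ invmx (Phi t omega) = Phi (- t) (theta t omega).
Proof.
move=> hPhi.
have inv : Phi (- t) (theta t omega) *m Phi t omega = 1%:M.
  by rewrite -(lc_cocycleD hPhi) addNr (lc_cocycle0 hPhi).
have [_ u] := mulmx1_unit inv; split=> //.
by rewrite -[LHS]mul1mx -inv mulmxK.
Qed.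

(** Measurability and domination together. It will be applied to the cocycle and
    its inverse, with g the power 1/alpha of the rough path norm. *)
Lemma sup_log_plus_integrable (R : realType) (d : measure_display)
    (Omega : measurableType d) (P : probability Omega R) (D : nat)
    (A1 A2 : R -> Omega -> 'M[R]_D) (g : Omega -> \bar R) (C : R) :
  (forall t i j, measurable_fun setT (fun omega => A1 t omega i j)) ->
  (forall t i j, measurable_fun setT (fun omega => A2 t omega i j)) ->
  (forall omega, continuous (A1 ^~ omega)) ->
  (forall omega, continuous (A2 ^~ omega)) ->
  P.-integrable setT g ->
  (forall omega, exists2 n : nat, (n%:R%:E <= C%:E * (1 + g omega))%E &
    forall t, 0 <= t <= 1 ->
      `|A1 t omega| <= 2 ^+ n /\ `|A2 t omega| <= 2 ^+ n) ->
  P.-integrable setT (fun omega =>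
    ereal_sup [set (log_plus `|A1 t omega|)%:E | t in `[0%R, 1%R]] +
    ereal_sup [set (log_plus `|A2 t omega|)%:E | t in `[0%R, 1%R]])%E.
Proof.
move=> mA1 mA2 cA1 cA2 ig bound.
have msup (A : R -> Omega -> 'M[R]_D) :
    (forall t i j, measurable_fun setT (fun omega => A t omega i j)) ->
    (forall omega, continuous (A ^~ omega)) ->
    measurable_fun setT (fun omega =>
      ereal_sup [set (log_plus `|A t omega|)%:E | t in `[0, 1]]).
  move=> mA cA; apply: (@measurable_sup_unit_itv _ _ _
    (fun t omega => log_plus `|A t omega|)) => [t|omega t].
    apply: measurableT_comp; last by apply: measurable_normr_mx; exact: mA.
    by apply: continuous_measurable_fun; exact: continuous_log_plus.
  apply: (@continuous_comp _ _ _ (fun t => `|A t omega|) (@log_plus R)).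
    by apply: cvg_norm; exact: cA.
  exact: continuous_log_plus.
have i1 : P.-integrable setT (fun omega => 1 + g omega)%E.
  by apply: integrableD => //; exact: finite_measure_integrable_cst.
apply: (le_integrable _ _ _ (integrableZl _ (2 * C) i1)) => //.
  by apply: emeasurable_funD; exact: msup.
move=> omega _; have [n nC bn] := bound omega.
have sup_ge0 (A : R -> Omega -> 'M[R]_D) :
    (0 <= ereal_sup [set (log_plus `|A t omega|)%:E | t in `[0%R, 1%R]])%E.
  apply: le_ereal_sup_tmp; exists (log_plus `|A 0 omega|)%:E.
    by exists 0 => //=; rewrite in_itv /= lexx ler01.
  by rewrite lee_fin log_plus_ge0.
rewrite gee0_abs ?adde_ge0//.
apply: (@le_trans _ _ (2%:E * n%:R%:E)%E).
  rewrite -EFinM mulrDl mul1r EFinD leeD//.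
    apply: ge_ereal_sup => _ [t /= + <-]; rewrite in_itv /= => /bn[b1 _].
    by rewrite lee_fin log_plus_pow2.
  apply: ge_ereal_sup => _ [t /= + <-]; rewrite in_itv /= => /bn[_ b2].
  by rewrite lee_fin log_plus_pow2.
apply: le_trans (lee_abs _); rewrite EFinM -muleA lee_wpmul2l//.
Qed.

Theorem lemma4p16 (R : realType) (M D : nat) (alpha : R)
    (halpha : 3^-1 < alpha <= 2^-1)
    (d : measure_display) (Omega : measurableType d) (P : probability Omega R)
    (theta : R -> Omega -> Omega)
    (hmds : metric_dynamical_system P theta)
    (W : Omega -> two_level_path R M)
    (hW : rough_path_cocycle alpha theta W)
    (hgeo : forall omega, weakly_geometric (W omega))
    (hint : forall a b, a < b ->
       P.-integrable setT
         (fun omega => poweR (rough_norm alpha a b (W omega)) alpha^-1))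
    (B0 : 'M[R]_D) (B : {linear 'cV[R]_D -> 'M[R]_(D, M)})
    (Phi : R -> Omega -> 'M[R]_D)
    (hPhi : linear_cocycle theta Phi)
    (hrde : generated_by_rde alpha B0 B W Phi) :
  met_integrable P Phi /\
  (multiplicative_ergodic_theorem R D -> has_oseledets_splitting P theta Phi).
Proof.
suff int : met_integrable P Phi by split=> // met; exact: met hmds hPhi int.
have inv t omega := linear_cocycle_inverse t omega hPhi.
have mPhi t i j : measurable_fun setT (fun omega => Phi t omega i j).
  exact: (measurableT_comp (lc_measurable hPhi i j) (pair1_measurable t)).
have mtheta t : measurable_fun setT (theta t).
  exact: (measurableT_comp (mds_measurable hmds) (pair1_measurable t)).
have [C growth] := rde_growth B0 B halpha.
apply: (sup_log_plus_integrable (C := C) _ _ _ _ (hint 0 1 ltr01)) => //.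
- move=> t i j.
  under eq_fun do rewrite (inv t _).2.
  exact: (measurableT_comp (mPhi (- t) i j) (mtheta t)).
- exact: (lc_continuous hPhi).
- move=> omega t; apply: continuous_invmx; last exact: (lc_continuous hPhi).
  by move=> s; exact: (inv s omega).1.
move=> omega.
have rW : rough_path_on alpha 0 1 (W omega) by exact: (rpc_rough hW).
have [w1 [w10 w1E _ _]] := holder2P ltr01 (rough_level1 rW).
have [w2 [w20 w2E _ _]] := holder2P ltr01 (rough_level2 rW).
have wE : rough_norm alpha 0 1 (W omega) = (w1 + w2)%:E.
  by rewrite /rough_norm w1E w2E.
have [n nC gn] := growth _ _ rW wE.
exists n; first by rewrite wE poweR_EFin -EFinD -EFinM lee_fin.
have {gn} gn t (y : 'cV[R]_D) : 0 <= t <= 1 ->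
    `|Phi t omega *m y| <= 2 ^+ n * `|y| /\ `|y| <= 2 ^+ n * `|Phi t omega *m y|.
  move=> t01; have [sol y0] := hrde omega y.
  have Yc : continuous (fun t => Phi t omega *m y).
    move=> s; apply: continuous_mulmx; last exact: cvg_cst.
    exact: (lc_continuous hPhi).
  by have := gn _ _ sol Yc t01; rewrite y0.
have n0 : 0 <= (2 : R) ^+ n by rewrite exprn_ge0.
move=> t t01; split; apply: normr_mx_operator => // y.
  by have [] := gn t y t01.
(* The lower bound, for the solution started at Phi(t)^-1 y. *)
have [_] := gn t (invmx (Phi t omega) *m y) t01.
by rewrite mulmxA mulmxV ?mul1mx//; exact: (inv t omega).1.
Qed.
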